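(* Let $n \geq 2$ be any integer. (i) The identities $x^{n+1} \approx x^n$ and $axy \approx ayx$ constitute an identity basis for the variety $\operatorname{var}\{LZ_2,N_n^1\}$ of semigroups. (ii) The variety $\operatorname{var}\{LZ_2,N_n^1\}$ contains countably infinitely many subvarieties (that is, its set of subvarieties is countably infinite).
   Context: All varieties are varieties of semigroups, and all identities are semigroup identities; associativity is always assumed. For semigroups $S,T$, $\operatorname{var}\{S,T\}$ denotes the variety generated by $S$ and $T$, i.e. the smallest class of semigroups containing $S$ and $T$ and closed under homomorphic images, subsemigroups, and arbitrary direct products. An identity basis for a variety $\mathbf{V}$ is a set of identities satisfied by $\mathbf{V}$ from which every identity satisfied by $\mathbf{V}$ can be deduced. $LZ_2$ is the left zero band of order $2$ (multiplication $xy=x$). $N_n=\langle a \mid a^n=0\rangle=\{a,a^2,\ldots,a^{n-1},0\}$ is the monogenic nilpotent semigroup of order $n$, and $N_n^1$ is the monoid obtained from $N_n$ by adjoining an identity element. *)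

(* Defs.v *)
From mathcomp Require Import all_boot.
From mathcomp Require Import zify.
From mathcomp Require Import boolp classical_sets cardinality.

Set Implicit Arguments.
Unset Strict Implicit.
Unset Printing Implicit Defensive.

Local Open Scope classical_set_scope.

(** Semigroups *)

(* MathComp's semigroupType is not used because of a universe constraint: its
   carriers range over a universe above the one of the argument of [set], so
   that a class of semigroups could not be a [set semigroupType]. *)
Record semigroup : Type := BuildSemigroup {
  carrier :> Type;
  sg_mul : carrier -> carrier -> carrier;
  sg_mulA : associative sg_mul;
  sg_inhabited : inhabited carrier
}.

Declare Scope sg_scope.
Delimit Scope sg_scope with sg.
Bind Scope sg_scope with carrier.
Notation "x * y" := (sg_mul x y) : sg_scope.
Local Open Scope sg_scope.

Definition homomorphism (S T : semigroup) (f : S -> T) : Prop :=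
  {morph f : x y / x * y}.

(* x ^ n; the value x at n = 0 is a dummy. *)
Definition sg_pow (S : semigroup) (x : S) (n : nat) : S :=
  iterop n (@sg_mul S) x x.

Section DirectProduct.
Variables (I : Type) (S : I -> semigroup).

Definition direct_prod_mul (x y : forall i, S i) : forall i, S i :=
  fun i => x i * y i.

Lemma direct_prod_mulA : associative direct_prod_mul.
Proof.
by move=> x y z; apply: functional_extensionality_dep => i; apply: sg_mulA.
Qed.

Lemma direct_prod_inhabited : inhabited (forall i, S i).
Proof.
have inhS i : exists x : S i, True by case: (sg_inhabited (S i)) => x; exists x.
by constructor=> i; case: (cid (inhS i)).
Qed.

Definition direct_prod : semigroup :=
  BuildSemigroup direct_prod_mulA direct_prod_inhabited.

End DirectProduct.

Lemma LZ2_mulA : associative (fun x y : bool => x).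
Proof. by []. Qed.

Definition LZ2 : semigroup := BuildSemigroup LZ2_mulA (inhabits true).

Section MonogenicNilpotent.
Variable n : nat.

Inductive nilsg_elt : Set :=
  | nilsg_zero
  | nilsg_power k of (0 < k < n)%N.

(* a ^ k, for k >= 1 *)
Definition nilsg_exp (k : nat) : nilsg_elt :=
  if @idP (0 < k < n)%N is ReflectT k_lt then nilsg_power k_lt else nilsg_zero.

Definition nilsg_mul (x y : nilsg_elt) : nilsg_elt :=
  match x, y with
  | nilsg_power i _, nilsg_power j _ => nilsg_exp (i + j)
  | _, _ => nilsg_zero
  end.

Lemma nilsg_expT k (k_lt : (0 < k < n)%N) : nilsg_exp k = nilsg_power k_lt.
Proof.
rewrite /nilsg_exp; case: {-}_ / idP => [k_lt'|/(_ k_lt) //].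
by rewrite (bool_irrelevance k_lt' k_lt).
Qed.

Lemma nilsg_expF k : ~~ (0 < k < n)%N -> nilsg_exp k = nilsg_zero.
Proof.
by move=> /negP k_nlt; rewrite /nilsg_exp; case: {-}_ / idP.
Qed.

Lemma nilsg_mul_expl i j (j_lt : (0 < j < n)%N) :
  (0 < i)%N -> nilsg_mul (nilsg_exp i) (nilsg_power j_lt) = nilsg_exp (i + j).
Proof.
move=> i_gt0; have [i_lt|i_nlt] := boolP (0 < i < n)%N.
  by rewrite (nilsg_expT i_lt).
by rewrite !nilsg_expF //; lia.
Qed.

Lemma nilsg_mul_expr i j (i_lt : (0 < i < n)%N) :
  (0 < j)%N -> nilsg_mul (nilsg_power i_lt) (nilsg_exp j) = nilsg_exp (i + j).
Proof.
move=> j_gt0; have [j_lt|j_nlt] := boolP (0 < j < n)%N.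
  by rewrite (nilsg_expT j_lt).
by rewrite !nilsg_expF //; lia.
Qed.

Lemma nilsg_mulA : associative nilsg_mul.
Proof.
move=> [|i i_lt] [|j j_lt] [|k k_lt] //=; last first.
  rewrite [LHS](nilsg_mul_expr i_lt) ?[RHS](nilsg_mul_expl k_lt) ?addnA //; lia.
by case: (nilsg_exp _).
Qed.

Definition nilsg : semigroup := BuildSemigroup nilsg_mulA (inhabits nilsg_zero).

End MonogenicNilpotent.

Section AdjoinIdentity.
Variable S : semigroup.

(* None is the adjoined identity element. *)
Definition adjoin1_mul (x y : option S) : option S :=
  match x, y with
  | Some s, Some t => Some (s * t)
  | None, _ => y
  | _, None => x
  end.

Lemma adjoin1_mulA : associative adjoin1_mul.
Proof. by move=> [x|] [y|] [z|] //=; rewrite sg_mulA. Qed.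

Definition adjoin1 : semigroup := BuildSemigroup adjoin1_mulA (inhabits None).

End AdjoinIdentity.

(** Varieties *)

Record variety (V : set semigroup) : Prop := Variety {
  variety_image : forall (S T : semigroup) (f : S -> T),
    homomorphism f -> range f = [set: T] -> V S -> V T;
  variety_sub : forall (S T : semigroup) (f : T -> S),
    homomorphism f -> injective f -> V S -> V T;
  variety_prod : forall (I : Type) (S : I -> semigroup),
    (forall i, V (S i)) -> V (direct_prod S)
}.

Definition var (G : set semigroup) : set semigroup := smallest variety G.

Definition subvarieties (V : set semigroup) : set (set semigroup) :=
  [set W | variety W /\ W `<=` V].

(** Identities *)

(* The free semigroup on the letters 0, 1, 2, ...: the pair (x, s) is the
   nonempty word x :: s. *)
Definition word_mul (u v : nat * seq nat) : nat * seq nat :=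
  (u.1, u.2 ++ v.1 :: v.2).

Lemma word_mulA : associative word_mul.
Proof. by move=> u v w; rewrite /word_mul /= -catA. Qed.

Definition word : semigroup := BuildSemigroup word_mulA (inhabits (0, [::])).

Definition letter (i : nat) : word := (i, [::]).

(* The homomorphism from words to S extending f; for S = word it is the
   substitution f. *)
Definition eval (S : semigroup) (f : nat -> S) (w : word) : S :=
  foldl (fun s i => s * f i) (f w.1) w.2.

(* The pair (u, v) is the identity u ~ v. *)
Definition identity : Type := (word * word)%type.

Definition satisfies (V : set semigroup) (e : identity) : Prop :=
  forall S : semigroup, V S ->
  forall f : nat -> S, eval f e.1 = eval f e.2.

(* Equational logic; associativity is built into words. *)
Inductive deducible (B : set identity) : word -> word -> Prop :=
  | deducible_ax u v : B (u, v) -> deducible B u v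
  | deducible_refl u : deducible B u u
  | deducible_sym u v : deducible B u v -> deducible B v u
  | deducible_trans u v w :
      deducible B u v -> deducible B v w -> deducible B u w
  | deducible_mul u v u' v' :
      deducible B u v -> deducible B u' v' -> deducible B (u * u') (v * v')
  | deducible_subst (f : nat -> word) u v :
      deducible B u v -> deducible B (eval f u) (eval f v).

Definition identity_basis (B : set identity) (V : set semigroup) : Prop :=
  (forall e, B e -> satisfies V e) /\
  (forall e, satisfies V e -> deducible B e.1 e.2).

(* Main.v *)
Require Import Defs.
From mathcomp Require Import all_boot.
From mathcomp Require Import zify.
From mathcomp Require Import boolp classical_sets cardinality.

Set Implicit Arguments.
Unset Strict Implicit.
Unset Printing Implicit Defensive.

Local Open Scope classical_set_scope.
Local Open Scope card_scope.
Local Open Scope sg_scope.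

(** By the two identities, the value of a word depends only on its first letter
    and on the number of occurrences of each letter truncated at n; conversely
    LZ_2 detects the first letter and N_n^1 the truncated numbers.

    By Birkhoff's theorem a subvariety W of V is determined by its identities.
    Label each letter of an identity u ~ v by whether it is the first letter of
    u, of v, and by its two truncated numbers of occurrences. If the identities
    d and e carry the same labels, each at most as often in d as in e, then
    modulo V the identity e is a substitution instance of d. By Dickson's lemma
    W is thus defined within V by finitely many identities, so there are only
    countably many subvarieties. The identities
    x_0 x_1 ... x_m ~ x_0 x_0 x_1 ... x_m define infinitely many of them,
    separated by the semigroups of subsets of {0, ..., k - 1} under disjoint
    union. *)

(** * Birkhoff's theorem *)

Section FreeSemigroup.
Variable X : Type.

Definition free_mul (u v : X * seq X) : X * seq X := (u.1, u.2 ++ v.1 :: v.2).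

Definition free_eval (S : semigroup) (f : X -> S) (w : X * seq X) : S :=
  foldl (fun s i => s * f i) (f w.1) w.2.

Lemma foldl_sg_mul (S : semigroup) (f : X -> S) (a b : S) (t : seq X) :
  foldl (fun s i => s * f i) (a * b) t = a * foldl (fun s i => s * f i) b t.
Proof. by elim: t a b => //= x t IH a b; rewrite -sg_mulA IH. Qed.

Lemma free_evalM (S : semigroup) (f : X -> S) u v :
  free_eval f (free_mul u v) = free_eval f u * free_eval f v.
Proof. by rewrite /free_eval /= foldl_cat /= foldl_sg_mul. Qed.

Lemma morph_free_eval (S T : semigroup) (h : S -> T) (f : X -> S) w :
  homomorphism h -> h (free_eval f w) = free_eval (h \o f) w.
Proof.
move=> hM; case: w => x s; rewrite /free_eval /=.
elim: s (f x) => //= y s IH a.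
by rewrite IH hM.
Qed.

Lemma free_eval_prod (I : Type) (S : I -> semigroup)
    (f : X -> direct_prod S) w i :
  free_eval f w i = free_eval (f^~ i) w.
Proof.
case: w => x s; rewrite /free_eval /=.
by elim: s (f x) => //= y s IH a; rewrite IH.
Qed.

End FreeSemigroup.

Lemma free_eval_map (X Y : Type) (S : semigroup) (g : Y -> S) (r : X -> Y) x s :
  free_eval g (r x, map r s) = free_eval (g \o r) (x, s).
Proof.
rewrite /free_eval /=.
by elim: s (g (r x)) => //= y s IH a.
Qed.

Lemma evalM (S : semigroup) (f : nat -> S) : homomorphism (eval f).
Proof. exact: free_evalM. Qed.

Lemma morph_eval (S T : semigroup) (h : S -> T) (f : nat -> S) w :
  homomorphism h -> h (eval f w) = eval (h \o f) w.
Proof. exact: morph_free_eval. Qed.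

Lemma eval_eval (S : semigroup) (f : nat -> S) (g : nat -> word) w :
  eval f (eval g w) = eval (fun i => eval f (g i)) w.
Proof. by rewrite (morph_eval _ _ (evalM f)). Qed.

Lemma sg_powS (S : semigroup) (x : S) k :
  sg_pow x k.+2 = x * sg_pow x k.+1.
Proof. by rewrite /sg_pow !iteropS. Qed.

Lemma morph_sg_pow (S T : semigroup) (h : S -> T) (x : S) k :
  homomorphism h -> h (sg_pow x k) = sg_pow (h x) k.
Proof.
by move=> hM; case: k => // k; elim: k => // k IH; rewrite !sg_powS hM IH.
Qed.

Definition holds (S : semigroup) (e : identity) : Prop :=
  forall f : nat -> S, eval f e.1 = eval f e.2.

Definition models (E : set identity) : set semigroup :=
  [set S | forall e, E e -> holds S e].

Definition identities (W : set semigroup) : set identity :=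
  [set e | satisfies W e].

Lemma models_variety (E : set identity) : variety (models E).
Proof.
split.
- move=> S T h hM hsurj VS e Ee f.
  have /choice[g hg] i : exists s, h s = f i.
    have [] : range h (f i) by rewrite hsurj.
    by move=> s _ <-; exists s.
  have -> : f = h \o g by apply/funext => i /=; rewrite hg.
  by rewrite -!(morph_eval _ _ hM) VS.
- move=> S T h hM hinj VS e Ee f; apply: hinj.
  by rewrite !(morph_eval _ _ hM) VS.
- move=> I S VS e Ee f; apply: functional_extensionality_dep => i.
  by rewrite /eval -!/(free_eval f _) !free_eval_prod; apply: VS.
Qed.

Lemma smallest_variety (G : set semigroup) : variety (var G).
Proof.
split.
- move=> S T h hM hsurj VS M [Mvar GM].
  by apply: (variety_image Mvar hM hsurj); apply: VS.
- move=> S T h hM hinj VS M [Mvar GM].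
  by apply: (variety_sub Mvar hM hinj); apply: VS.
- move=> I S VS M [Mvar GM].
  by apply: (variety_prod Mvar) => i; apply: VS.
Qed.

(* An identity between words over an arbitrary alphabet involves finitely many
   letters, so it can be renamed to an identity over the letters [nat]. *)
Lemma holds_free (W : set semigroup) (S : semigroup) (X : Type)
    (u v : X * seq X) :
  models (identities W) S ->
  (forall T, W T -> forall g : X -> T, free_eval g u = free_eval g v) ->
  forall g : X -> S, free_eval g u = free_eval g v.
Proof.
move=> WS uv g.
pose L := u.1 :: u.2 ++ v.1 :: v.2.
pose r := nth u.1 L.
pose idx x := find (fun y => `[<y = x>]) L.
have rK : all (fun x => `[<r (idx x) = x>]) L.
  apply/(all_nthP u.1) => i iL; apply/asboolP.
  suff /(nth_find u.1)/asboolP : has (fun y => `[<y = nth u.1 L i>]) L by [].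
  by apply/(has_nthP u.1); exists i => //; apply/asboolP.
have rename (w : X * seq X) :
    all (fun x => `[<r (idx x) = x>]) (w.1 :: w.2) ->
    w = (r (idx w.1), map r (map idx w.2)).
  case: w => x s /= /andP[/asboolP -> sK]; congr pair.
  by elim: s sK => //= y s IH /andP[/asboolP -> /IH <-].
have uK : all (fun x => `[<r (idx x) = x>]) (u.1 :: u.2).
  by move: rK; rewrite /L -cat_cons all_cat => /andP[].
have vK : all (fun x => `[<r (idx x) = x>]) (v.1 :: v.2).
  by move: rK; rewrite /L -cat_cons all_cat => /andP[].
pose e : identity := ((idx u.1, map idx u.2), (idx v.1, map idx v.2)).
suff eW : satisfies W e.
  rewrite (rename u uK) (rename v vK) !(free_eval_map g r).
  exact: WS e eW (g \o r).
move=> T WT f; rewrite [LHS]free_eval_map [RHS]free_eval_map.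
exact: uv.
Qed.

(* Birkhoff. The free object over the letters S embeds in the product of
   semigroups of W that separate the pairs of words not identified by W. *)
Lemma variety_models (W : set semigroup) :
  variety W -> W = models (identities W).
Proof.
move=> Wvar; apply/seteqP; split=> S; first by move=> WS e; exact.
move=> SW; have [x0] := sg_inhabited S.
pose wd := (S * seq S)%type.
have /choice[D hD] (i : wd * wd) : exists D : {T : semigroup & S -> T},
    W (projT1 D) /\ (free_eval (projT2 D) i.1 = free_eval (projT2 D) i.2 ->
      forall T, W T -> forall g : S -> T, free_eval g i.1 = free_eval g i.2).
  have [[T [WT [g neq]]]|noT] := pselect (exists T, W T /\
      exists g : S -> T, free_eval g i.1 <> free_eval g i.2).
    by exists (existT _ T g); split.
  (* If no semigroup of [W] separates the pair, its component is filled by the empty product, a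
     one-element semigroup in [W]. *)
  pose T0 := direct_prod (fun b : Empty_set => match b with end : semigroup).
  have WT0 : W T0 by apply: (variety_prod Wvar); case.
  have [t0] := sg_inhabited T0.
  exists (existT (fun T : semigroup => S -> T) T0 (fun=> t0)).
  split=> // _ T WT g.
  by apply: contrapT => neq; apply: noT; exists T; split=> //; exists g.
pose P := direct_prod (fun i => projT1 (D i)).
have WP : W P by apply: (variety_prod Wvar) => i; case: (hD i).
pose gen : S -> P := fun x i => projT2 (D i) x.
(* Component [(u, v)] of [P] separates [u] from [v] if anything in [W] does. So words with equal
   values in [P] agree under all assignments into [W], hence in [S]. *)
have sep u v : free_eval gen u = free_eval gen v ->
    free_eval id u = free_eval id v :> S.
  move=> /(congr1 (fun p : P => p (u, v))); rewrite !free_eval_prod /= => uv.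
  by apply: (holds_free SW) => T WT g; apply: (proj2 (hD (u, v)) uv).
pose F0 := {p : P | exists w, p = free_eval gen w}.
have memM (p q : F0) : exists w, (sval p * sval q : P) = free_eval gen w.
  case: p q => [p [u pu]] [q [v qv]] /=.
  by exists (free_mul u v); rewrite free_evalM -pu -qv.
pose mulF (p q : F0) : F0 := exist _ _ (memM p q).
have valI (p q : F0) : sval p = sval q -> p = q.
  by case: p q => [p hp] [q hq] /= pq; apply: eq_exist.
have mulFA : associative mulF.
  by move=> p q r; apply: valI; exact: (@sg_mulA P).
have memgen w : exists w', free_eval gen w = free_eval gen w' by exists w.
pose elt w : F0 := exist _ _ (memgen w).
pose F := BuildSemigroup mulFA (inhabits (elt (x0, [::]))).
have WF : W F.
  apply: (@variety_sub _ Wvar P F (fun p : F => sval p)) => //.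
have /choice[word_of wordP] (p : F) : exists w, sval p = free_eval gen w.
  by case: p.
(* [h] reads a word representing [p] in [S]; by [sep] the choice of the word does not matter. *)
pose h (p : F) : S := free_eval id (word_of p).
apply: (variety_image Wvar (f := h)) WF.
  move=> p q; rewrite /h -free_evalM; apply: sep.
  by rewrite -wordP free_evalM -!wordP.
apply/seteqP; split=> // s _.
exists (elt (s, [::]) : F) => //.
by rewrite /h (sep _ (s, [::])) // -wordP.
Qed.

Lemma deducible_sound (B : set identity) S u v :
  models B S -> deducible B u v -> holds S (u, v).
Proof.
move=> BS; elim=> {u v} [u v /BS //|//|u v _ IH f|u v w _ uv _ vw f|
  u v u' v' _ IH _ IH' f|g u v _ IH f].
- by rewrite [LHS]/= -IH.
- by rewrite uv vw.
- by rewrite /= !evalM [eval f u]IH [eval f u']IH'.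
- by rewrite /= !eval_eval [LHS]IH.
Qed.

Lemma identity_basis_models (B : set identity) (V : set semigroup) :
  variety V -> identity_basis B V -> V = models B.
Proof.
move=> Vvar [BV VB]; apply/seteqP; split=> S VS.
  by move=> e /BV; apply.
rewrite (variety_models Vvar) => -[u v] /VB.
exact: deducible_sound.
Qed.

(** * Finite bases relative to V *)

(** Induction on the coordinates. Let [s0] serve the coordinates other than [k]. Elements whose
    [k]-coordinate is at least that of every member of [s0] are dominated by [s0]; the others take
    finitely many values at [k], and the induction hypothesis is applied to each value. *)
Lemma dickson_seq (K T : eqType) (h : T -> K -> nat) (ks : seq K) (A : set T) :
  exists2 s : seq T, (forall t, t \in s -> A t) &
    forall a, A a ->
      exists2 b, b \in s & forall k, k \in ks -> (h b k <= h a k)%N.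
Proof.
elim: ks A => [|k ks IH] A.
  have [[a Aa]|noA] := pselect (exists a, A a).
    exists [:: a] => [t|b _]; first by rewrite inE => /eqP ->.
    by exists a; rewrite ?inE.
  by exists [::] => // a Aa; case: noA; exists a.
have [s0 s0A s0P] := IH A.
have below m : exists2 s : seq T, (forall t, t \in s -> A t) &
    forall a, A a -> (h a k < m)%N ->
      exists2 b, b \in s & forall k', k' \in k :: ks -> (h b k' <= h a k')%N.
  elim: m => [|m [s sA sP]]; first by exists [::].
  have [s' s'A s'P] := IH [set a | A a /\ h a k = m].
  exists (s ++ s') => [t|a Aa].
    by rewrite mem_cat => /orP[/sA //|/s'A[]].
  rewrite ltnS leq_eqVlt => /orP[/eqP hak|/(sP a Aa)[b bs bP]]; last first.
    by exists b; rewrite // mem_cat bs.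
  have [b bs' bP] := s'P a (conj Aa hak).
  exists b; rewrite ?mem_cat ?bs' ?orbT //.
  move=> k'; rewrite inE => /orP[/eqP ->|]; last exact: bP.
  by have [_ ->] := s'A b bs'; rewrite hak.
have [s sA sP] := below (\max_(b <- s0) h b k).
exists (s0 ++ s) => [t|a Aa].
  by rewrite mem_cat => /orP[/s0A|/sA].
have [lt_max|ge_max] := ltnP (h a k) (\max_(b <- s0) h b k).
  by have [b bs bP] := sP a Aa lt_max; exists b; rewrite // mem_cat bs orbT.
have [b bs0 bP] := s0P a Aa; exists b; rewrite ?mem_cat ?bs0 //.
move=> k'; rewrite inE => /orP[/eqP ->|]; last exact: bP.
by apply: leq_trans ge_max; apply: leq_bigmax_seq.
Qed.

Lemma dickson (K : finType) (T : eqType) (h : T -> K -> nat) (A : set T) :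
  exists2 s : seq T, (forall t, t \in s -> A t) &
    forall a, A a -> exists2 b, b \in s & forall k, (h b k <= h a k)%N.
Proof.
have [s sA sP] := dickson_seq h (enum K) A; exists s => // a /sP[b bs bP].
by exists b => // k; apply: bP; rewrite mem_enum.
Qed.

(** Within each label, the i-th element of [s'] goes to the i-th element of [s], and surplus
    elements go to the last one. The inequality makes this onto; the condition on zero counts
    provides a target for every element of [s']. *)
Lemma label_surjection (L T T' : eqType) (lab : T -> L) (lab' : T' -> L)
    (s : seq T) (s' : seq T') (x0 : T) :
  uniq s' ->
  (forall l, count (fun x => lab x == l) s <=
             count (fun y => lab' y == l) s')%N ->
  (forall l, count (fun x => lab x == l) s = 0 ->
             count (fun y => lab' y == l) s' = 0)%N ->
  exists p : T' -> T,
    (forall y, y \in s' -> lab (p y) = lab' y) /\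
    (forall x, x \in s -> exists2 y, y \in s' & p y = x).
Proof.
move=> s'U le_count count0.
pose fib l := [seq x <- s | lab x == l].
pose fib' l := [seq y <- s' | lab' y == l].
pose p y := nth x0 (fib (lab' y))
  (minn (index y (fib' (lab' y))) (size (fib (lab' y))).-1).
exists p; split=> [y ys'|x xs].
  have fib_gt0 : (0 < size (fib (lab' y)))%N.
    rewrite lt0n size_filter; apply/eqP => /count0/eqP.
    rewrite -[_ == 0]negbK -lt0n -has_count => /hasPn/(_ y ys').
    by rewrite eqxx.
  have : p y \in fib (lab' y) by rewrite mem_nth //; lia.
  by rewrite mem_filter => /andP[/eqP].
have xfib : x \in fib (lab x) by rewrite mem_filter eqxx.
have ltx : (index x (fib (lab x)) < size (fib (lab x)))%N by rewrite index_mem.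
have ltx' : (index x (fib (lab x)) < size (fib' (lab x)))%N.
  by apply: leq_trans ltx _; rewrite !size_filter.
have [y0] : exists y0 : T', y0 \in fib' (lab x).
  by case: (fib' (lab x)) ltx' => // y0 r _; exists y0; rewrite mem_head.
move=> _; pose y := nth y0 (fib' (lab x)) (index x (fib (lab x))).
have : y \in fib' (lab x) by rewrite mem_nth.
rewrite mem_filter => /andP[/eqP laby ys']; exists y => //.
rewrite /p laby /y index_uniq ?filter_uniq //.
by rewrite (minn_idPl _) ?nth_index // -ltnS prednK // (leq_ltn_trans _ ltx).
Qed.

(** * Truncated letter counts and labels of identities *)

Definition letters (w : word) : seq nat := w.1 :: w.2.
Arguments letters : simpl never.

(* Equality of words in var {LZ2, N_n^1}. *)
Definition trunc_equiv (n : nat) (u v : word) : Prop :=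
  u.1 = v.1 /\
  forall x, minn n (count_mem x (letters u)) = minn n (count_mem x (letters v)).

Lemma letters_eval (g : nat -> word) w :
  letters (eval g w) = flatten [seq letters (g x) | x <- letters w].
Proof.
case: w => x s; rewrite /eval /letters /=.
elim: s (g x) => [|y s IH] u /=; first by rewrite cats0.
by rewrite IH /= -!catA.
Qed.

Lemma eval_head (g : nat -> word) w : (eval g w).1 = (g w.1).1.
Proof. by have := letters_eval g w; case: w => x s [-> _]. Qed.

(* An identity e is determined, up to renaming its letters and modulo
   trunc_equiv, by the number of its letters with each label. *)
Definition label (n : nat) (e : identity) (x : nat) :
    bool * bool * ('I_n.+1 * 'I_n.+1) :=
  (x == e.1.1, x == e.2.1,
   (inord (minn n (count_mem x (letters e.1))),
    inord (minn n (count_mem x (letters e.2))))).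

Definition content (e : identity) : seq nat :=
  undup (letters e.1 ++ letters e.2).

Definition label_count (n : nat) (e : identity) l : nat :=
  count (fun x => label n e x == l) (content e).
Arguments label_count : clear implicits.

Lemma label_eq_count n d e x y : label n d x = label n e y ->
  minn n (count_mem x (letters d.1)) = minn n (count_mem y (letters e.1)) /\
  minn n (count_mem x (letters d.2)) = minn n (count_mem y (letters e.2)).
Proof.
have K m : (inord (minn n m) : 'I_n.+1) = minn n m :> nat.
  by rewrite inordK // ltnS geq_minl.
by case=> _ _ /(congr1 val) /= + /(congr1 val) /=; rewrite !K.
Qed.

(* Substitute for each letter of d the product of its preimages under a
   label-preserving surjection from the letters of e. *)
Lemma label_count_subst n (d e : identity) :
  (forall l, label_count n d l <= label_count n e l)%N ->
  (forall l, label_count n d l = 0 -> label_count n e l = 0)%N ->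
  exists g : nat -> word,
    trunc_equiv n (eval g d.1) e.1 /\ trunc_equiv n (eval g d.2) e.2.
Proof.
move=> le_count count0.
have [p [pP p_onto]] := label_surjection 0%N (undup_uniq _) le_count count0.
pose fib x := [seq y <- content e | p y == x].
pose g x : word := (head 0 (fib x), behead (fib x)).
have lettersg x : x \in content d -> letters (g x) = fib x.
  move=> /p_onto[y ye pyx]; rewrite /letters /g.
  have : y \in fib x by rewrite mem_filter pyx eqxx.
  by case: (fib x).
have headg x : x \in content d -> (g x).1 \in fib x.
  by move=> /lettersg <-; rewrite mem_head.
(* The fibres of [p] are disjoint, so [y] occurs in [eval g w] once for each occurrence of [p y] in
   [w]. *)
have countg (w : word) : {subset letters w <= content d} ->
    forall y, count_mem y (letters (eval g w)) =
      if y \in content e then count_mem (p y) (letters w) else 0.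
  move=> wd y; rewrite letters_eval.
  have /eq_in_map -> : {in letters w, (fun x => letters (g x)) =1 fib}.
    by move=> x /wd; apply: lettersg.
  elim: (letters w) => [|x s IH] /=; first by case: ifP.
  rewrite count_cat IH (count_uniq_mem y (filter_uniq _ (undup_uniq _))).
  by rewrite mem_filter eq_sym; case: (y \in content e); rewrite ?andbT ?andbF.
have sub1 : {subset letters d.1 <= content d}.
  by move=> x xd; rewrite mem_undup mem_cat xd.
have sub2 : {subset letters d.2 <= content d}.
  by move=> x xd; rewrite mem_undup mem_cat xd orbT.
have headP x : x \in content d -> p (g x).1 = x /\ (g x).1 \in content e.
  by move=> /headg; rewrite mem_filter => /andP[/eqP].
exists g; split; split.
(* Labels record first letters, so a letter that [p] sends to the first letter of [d.1] is the first
   letter of [e.1]. *)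
- have [|px ge] := headP d.1.1; first by rewrite sub1 // mem_head.
  have := pP _ ge; rewrite px eval_head => -[+ _ _ _].
  by rewrite eqxx => /esym/eqP.
- move=> y; rewrite (countg _ sub1); case: ifPn => ye.
    by have [] := label_eq_count (pP y ye).
  move: ye; rewrite mem_undup mem_cat negb_or => /andP[ye _].
  by rewrite (count_memPn ye).
- have [|px ge] := headP d.2.1; first by rewrite sub2 // mem_head.
  have := pP _ ge; rewrite px eval_head => -[_ + _ _].
  by rewrite eqxx => /esym/eqP.
- move=> y; rewrite (countg _ sub2); case: ifPn => ye.
    by have [] := label_eq_count (pP y ye).
  move: ye; rewrite mem_undup mem_cat negb_or => /andP[_ ye].
  by rewrite (count_memPn ye).
Qed.

Lemma models_label_count n (S : semigroup) (d e : identity) :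
  (forall u v, trunc_equiv n u v -> holds S (u, v)) ->
  (forall l, label_count n d l <= label_count n e l)%N ->
  (forall l, label_count n d l = 0 -> label_count n e l = 0)%N ->
  holds S d -> holds S e.
Proof.
move=> trunc_holds le_count count0 Sd f.
have [g [/trunc_holds g1 /trunc_holds g2]] := label_count_subst le_count count0.
by rewrite -[LHS]g1 -[RHS]g2 /= !eval_eval; apply: Sd.
Qed.

(* Dickson's lemma is applied to the label counts together with the booleans
   telling whether they are zero. *)
Lemma finite_relative_basis n (A : set identity) :
  exists2 s : seq identity, [set` s] `<=` A &
    forall S, (forall u v, trunc_equiv n u v -> holds S (u, v)) ->
      models [set` s] S -> models A S.
Proof.
pose h (e : identity) (lb : (bool * bool * ('I_n.+1 * 'I_n.+1)) * bool) : nat :=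
  if lb.2 then label_count n e lb.1 else (label_count n e lb.1 == 0%N).
have [s sA sP] := dickson h A.
exists s; first exact: sA.
move=> S trunc_holds Ss e /sP[d ds dP].
apply: (models_label_count trunc_holds (d := d)) => [l|l l0|]; last exact: Ss.
  exact: dP (l, true).
by have := dP (l, false); rewrite /h /= l0 /=; case: eqP.
Qed.

(** * Identities of LZ_2 and N_n^1 *)

Arguments sg_pow : simpl never.

Definition basis (n : nat) : set identity :=
  [set (sg_pow (letter 0) n.+1, sg_pow (letter 0) n);
       (letter 2 * letter 0 * letter 1, letter 2 * letter 1 * letter 0)].

Lemma models_basis n S : models (basis n) S <->
  (forall x : S, sg_pow x n.+1 = sg_pow x n) /\
  (forall a x y : S, a * x * y = a * y * x).
Proof.
split=> [BS|[powS swapS] e [->|->] f /=].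
- split=> [x|a x y].
    have := BS _ (or_introl erefl) (fun=> x).
    by rewrite /= !(morph_sg_pow _ _ (@evalM _ _)).
  exact: (BS _ (or_intror erefl) (fun i => nth a [:: x; y] i)).
- by rewrite !(morph_sg_pow _ _ (@evalM _ _)).
- exact: swapS.
Qed.

Lemma sg_pow_letter x k : sg_pow (letter x) k.+1 = (x, nseq k x).
Proof. by elim: k => // k IH; rewrite sg_powS IH. Qed.

(** * Deductions from the two identities *)

Section Deduction.
Variable n : nat.
Hypothesis n_gt0 : (0 < n)%N.

Local Notation ded := (deducible (basis n)).

Lemma deducible_cat u v s : ded u v -> ded (u.1, u.2 ++ s) (v.1, v.2 ++ s).
Proof.
case: s => [|x s] uv; first by rewrite !cats0; case: u v uv => [? ?] [? ?].
exact: deducible_mul uv (deducible_refl _ (x, s)).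
Qed.

Lemma deducible_swap (a x y : word) : ded (a * x * y) (a * y * x).
Proof.
pose f i := nth a [:: x; y] i.
have ax : ded (letter 2 * letter 0 * letter 1) (letter 2 * letter 1 * letter 0).
  by apply: deducible_ax; right.
exact: (deducible_subst f ax).
Qed.

Lemma deducible_pow x : ded (x, nseq n x) (x, nseq n.-1 x).
Proof.
rewrite -!sg_pow_letter (prednK n_gt0).
have ax : ded (sg_pow (letter 0) n.+1) (sg_pow (letter 0) n).
  by apply: deducible_ax; left.
have := deducible_subst (fun=> letter x) ax.
by rewrite !(morph_sg_pow _ _ (@evalM _ _)).
Qed.

Lemma deducible_perm h s s' : perm_eq s s' -> ded (h, s) (h, s').
Proof.
elim: s s' h => [|x s IH] s' h.
  by rewrite perm_sym => /perm_nilP ->; apply: deducible_refl.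
move=> sP; have xs' : x \in s' by rewrite -(perm_mem sP) mem_head.
case/splitPr: xs' sP => p q sP.
have {}sP : perm_eq s (p ++ q).
  by rewrite -(perm_cons x) (permPl sP) perm_catC /= perm_cons perm_catC.
apply: (deducible_trans (v := (h, x :: p ++ q))).
  exact: deducible_mul (deducible_refl _ (letter h)) (IH _ x sP).
case: p {sP} => [|y p]; first exact: deducible_refl.
(* The whole block [(y, p)] is substituted for one letter, so a single swap carries [x] past it. *)
have := deducible_cat q (deducible_swap (letter h) (letter x) (y, p)).
by rewrite /= /word_mul /= -catA.
Qed.

Lemma perm_nseq_cat (x : nat) s k :
  (k <= count_mem x s)%N -> exists s', perm_eq s (nseq k x ++ s').
Proof.
elim: k => [_|k IH ltk]; first by exists s.
have [s' sP] := IH (ltnW ltk).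
have xs' : x \in s'.
  move: ltk; rewrite (permP sP) count_cat count_nseq /= eqxx mul1n.
  by rewrite -addn1 leq_add2l -has_count has_pred1.
exists (rem x s').
by rewrite (permPl sP) -[k.+1]addn1 nseqD -catA perm_cat2l perm_to_rem.
Qed.

(** Permuting the tail gathers the copies of [x], their n-th power is raised by one, and the tail is
    permuted back. If [h] is [x], the head itself supplies one of the [n] copies. *)
Lemma deducible_pump h s x :
  (n <= count_mem x (h :: s))%N -> ded (h, s) (h, x :: s).
Proof.
have [->|hx] := eqVneq h x; rewrite /= ?eqxx ?(negbTE hx) ?add0n ?add1n.
  rewrite -{1}(prednK n_gt0) ltnS => /perm_nseq_cat[s' sP].
  apply: deducible_trans (deducible_perm _ sP) _.
  apply: deducible_trans (deducible_perm x (s := nseq n x ++ s') _).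
    exact: deducible_cat s' (deducible_sym (deducible_pow x)).
  by rewrite -{1}(prednK n_gt0) perm_cons perm_sym.
move=> /perm_nseq_cat[s' sP].
apply: deducible_trans (deducible_perm _ sP) _.
apply: deducible_trans (deducible_perm h (s := x :: nseq n x ++ s') _).
  rewrite [in X in ded X _](_ : nseq n x = x :: nseq n.-1 x);
    last by rewrite -[in LHS](prednK n_gt0).
  exact: deducible_mul (deducible_refl _ (letter h))
    (deducible_cat s' (deducible_sym (deducible_pow x))).
by rewrite perm_cons perm_sym.
Qed.

Lemma deducible_pumps h s d :
  (forall x, x \in d -> (n <= count_mem x (h :: s))%N) ->
  ded (h, s) (h, d ++ s).
Proof.
elim: d => [_|x d IH dP] /=; first exact: deducible_refl.
apply: (deducible_trans (v := (h, d ++ s))).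
  by apply: IH => y yd; rewrite dP // inE yd orbT.
apply: deducible_pump; apply: leq_trans (dP x (mem_head _ _)) _.
by rewrite /= count_cat addnCA leq_addl.
Qed.

Lemma multiset_diff (s t : seq nat) :
  exists d, forall x, count_mem x d = count_mem x t - count_mem x s.
Proof.
elim: s => [|y s [d dP]]; first by exists t => x; rewrite subn0.
by exists (rem y d) => x; rewrite count_mem_rem dP /= subnAC subnDA subnAC.
Qed.

(* Both words are pumped up to the multiset union of their tails. *)
Lemma trunc_equiv_deducible u v : trunc_equiv n u v -> ded u v.
Proof.
case: u v => h s [h' t] [/= <- st].
have [ds dsP] := multiset_diff s t; have [dt dtP] := multiset_diff t s.
(* A letter of [d] occurs more often in [s2] than in [s1]; since the truncated numbers agree, it
   already occurs at least [n] times in [h :: s1]. *)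
have pump (s1 s2 d : seq nat) :
    (forall x,
       minn n (count_mem x (h :: s1)) = minn n (count_mem x (h :: s2))) ->
    (forall x, count_mem x d = count_mem x s2 - count_mem x s1) ->
    ded (h, s1) (h, d ++ s1).
  move=> s12 dP; apply: deducible_pumps => x.
  rewrite -has_pred1 has_count dP; have /= := s12 x; lia.
apply: deducible_trans (pump _ _ _ st dsP) _.
apply: deducible_trans (deducible_sym (pump _ _ _ (fun x => esym (st x)) dtP)).
apply: deducible_perm; apply/allP => x _ /=; apply/eqP.
by rewrite !count_cat dsP dtP ![(_ - _ + _)%N]addnC -!maxnE maxnC.
Qed.

End Deduction.

(** * The identities of the two generators *)

Lemma LZ2_basis n : models (basis n) LZ2.
Proof.
apply/models_basis; split=> // x.
have powE k : sg_pow x k = x :> LZ2 by case: k => // -[|k]; rewrite ?sg_powS.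
by rewrite !powE.
Qed.

Lemma LZ2_eval (f : nat -> LZ2) w : eval f w = f w.1.
Proof. by case: w => x s; rewrite /eval /=; elim: s (f x) => //= y s IH b. Qed.

Section MonogenicNilpotentMonoid.
Variable n : nat.
Hypothesis n_gt1 : (1 < n)%N.

Definition nil1_exp (k : nat) : adjoin1 (nilsg n) :=
  if k is 0 then None else Some (nilsg_exp n k).

Lemma nilsg_expD i j : (0 < i)%N -> (0 < j)%N ->
  nilsg_mul (nilsg_exp n i) (nilsg_exp n j) = nilsg_exp n (i + j).
Proof.
move=> i_gt0 j_gt0; have [j_lt|j_nlt] := boolP (0 < j < n)%N.
  by rewrite (nilsg_expT j_lt) nilsg_mul_expl.
have [-> ->] : nilsg_exp n j = nilsg_zero n /\
    nilsg_exp n (i + j) = nilsg_zero n.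
  by split; apply: nilsg_expF; lia.
by case: (nilsg_exp n i).
Qed.

Lemma nil1_expD i j : nil1_exp i * nil1_exp j = nil1_exp (i + j).
Proof.
case: i j => [|i] [|j] //=; first by rewrite addn0.
by congr Some; apply: nilsg_expD.
Qed.

Lemma nil1_exp_onto x : exists k, x = nil1_exp k.
Proof.
case: x => [[|k k_lt]|]; last by exists 0.
  by exists n.+1; rewrite /= nilsg_expF //; lia.
by exists k; case: k k_lt => // k k_lt; rewrite /nil1_exp (nilsg_expT k_lt).
Qed.

Lemma nil1_exp_inj i j : nil1_exp i = nil1_exp j -> minn n i = minn n j.
Proof.
(* The truncated exponent: the adjoined identity counts as the power 0, the zero element as the
   power [n]. *)
pose deg (x : option (nilsg_elt n)) :=
  match x with
  | None => 0 | Some (nilsg_power k _) => k | Some (nilsg_zero) => n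
  end.
have degK k : deg (nil1_exp k) = minn n k.
  case: k => [|k]; first by rewrite minn0.
  rewrite /nil1_exp; have [k_lt|k_nlt] := boolP (0 < k.+1 < n)%N.
    by rewrite (nilsg_expT k_lt) /=; lia.
  by rewrite nilsg_expF //=; lia.
by move=> ij; rewrite -!degK ij.
Qed.

Lemma nil1_exp_trunc i j : minn n i = minn n j -> nil1_exp i = nil1_exp j.
Proof.
move=> ij; have [->//|neq] := eqVneq i j.
case: i j => [|i] [|j] in ij neq *; try lia.
by congr Some; rewrite !nilsg_expF //; lia.
Qed.

Lemma nil1_basis : models (basis n) (adjoin1 (nilsg n)).
Proof.
apply/models_basis; split=> [x|a x y].
  have [k ->] := nil1_exp_onto x.
  have powE m : (0 < m)%N -> sg_pow (nil1_exp k) m = nil1_exp (k * m).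
    case: m => // m _; elim: m => [|m IH]; first by rewrite muln1.
    by rewrite sg_powS IH nil1_expD -mulnS.
  (* For [k = 0] both powers are the identity; for positive [k] both exponents are at least [n], so
     both powers are zero. *)
  rewrite !powE ?(ltnW n_gt1) //; apply: nil1_exp_trunc.
  by case: k {powE} => [|k]; rewrite ?mul0n // !mulSn; lia.
have [i ->] := nil1_exp_onto a; have [j ->] := nil1_exp_onto x.
by have [k ->] := nil1_exp_onto y; rewrite !nil1_expD addnAC.
Qed.

(** Sending [x] to the generator and every other letter to the identity element counts the
    occurrences of [x]. *)
Lemma nil1_eval x w :
  eval (fun i => nil1_exp (i == x)) w = nil1_exp (count_mem x (letters w)).
Proof.
case: w => y s; rewrite /eval /letters /=.
elim: s (nat_of_bool (y == x)) => [|z s IH] c; first by rewrite addn0.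
by rewrite [RHS]/= addnA -IH -nil1_expD.
Qed.

Lemma holds_trunc_equiv u v :
  holds LZ2 (u, v) -> holds (adjoin1 (nilsg n)) (u, v) -> trunc_equiv n u v.
Proof.
move=> LZ_uv nil_uv; split=> [|x].
  have := LZ_uv (fun i => i == u.1); rewrite /= !LZ2_eval eqxx.
  by move/esym/eqP.
by apply: nil1_exp_inj; rewrite -!nil1_eval; apply: nil_uv.
Qed.

End MonogenicNilpotentMonoid.

(** * Semigroups of disjoint unions *)

Section DisjointUnions.
Variable k : nat.

(* The subsets of {0, ..., k - 1} under disjoint union; the empty set is the
   zero element, and not an identity. A subset is represented by any predicate
   that agrees with it below k. The finite sets {set 'I_k} would exceed the
   universe of the carriers. *)
Definition inhab (A : nat -> bool) : bool := has A (iota 0 k).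

Definition dunion_mul (A B : nat -> bool) : nat -> bool :=
  if [&& inhab A, inhab B & ~~ inhab (predI A B)]
  then fun i => (i < k)%N && (A i || B i) else xpred0.

Lemma eq_inhab (A B : nat -> bool) :
  (forall i, (i < k)%N -> A i = B i) -> inhab A = inhab B.
Proof. by move=> AB; apply: eq_in_has => i; rewrite mem_iota => /AB. Qed.

Lemma inhab0 : inhab xpred0 = false.
Proof. exact: has_pred0. Qed.

Lemma inhabU A B :
  inhab (fun i => (i < k)%N && (A i || B i)) = inhab A || inhab B.
Proof. by rewrite -[RHS]has_predU; apply: eq_inhab => i ->. Qed.

Lemma inhabIU A B C :
  inhab (predI A (fun i => (i < k)%N && (B i || C i))) =
  inhab (predI A B) || inhab (predI A C).
Proof.
rewrite -[RHS]has_predU; apply: eq_inhab => i ik /=.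
by rewrite ik; apply: andb_orr.
Qed.

Lemma inhabIC A B : inhab (predI A B) = inhab (predI B A).
Proof. by apply: eq_inhab => i _; apply: andbC. Qed.

Lemma inhabUI A B C :
  inhab (predI (fun i => (i < k)%N && (A i || B i)) C) =
  inhab (predI A C) || inhab (predI B C).
Proof. by rewrite inhabIC inhabIU !(inhabIC C). Qed.

(** Either bracketing gives the union when the three sets are nonempty and pairwise disjoint, and
    the empty set otherwise. *)
Lemma dunion_mulA : associative dunion_mul.
Proof.
move=> A B C; rewrite /dunion_mul.
case A0: (inhab A) => /=; last by rewrite inhab0.
case B0: (inhab B) => /=; last by rewrite inhab0.
case C0: (inhab C) => /=; last by rewrite inhab0 andbF.
case BC: (inhab (predI B C)); case AB: (inhab (predI A B)) => /=.
- by rewrite inhab0.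
- by rewrite inhab0 inhabU A0 inhabUI BC orbT.
- by rewrite inhab0 inhabIU AB andbF.
- rewrite !inhabU A0 B0 inhabIU AB inhabUI BC orbF.
  case: (inhab (predI A C)) => //=; apply/funext => i.
  by case: (i < k)%N; rewrite //= orbA.
Qed.

Definition dunion : semigroup := BuildSemigroup dunion_mulA (inhabits xpred0).

Lemma dunion_sqr (A : dunion) : A * A = (xpred0 : dunion).
Proof.
rewrite /= /dunion_mul (@eq_inhab (predI A A) A) => [|i _]; last exact: andbb.
by case: (inhab A).
Qed.

Lemma dunion_mulC : commutative (@sg_mul dunion).
Proof.
move=> A B; rewrite /= /dunion_mul inhabIC andbCA; case: ifP => // _.
by apply/funext => i; rewrite orbC.
Qed.

Lemma dunion_mul0 (A : dunion) : (xpred0 : dunion) * A = (xpred0 : dunion).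
Proof. by rewrite /= /dunion_mul inhab0. Qed.

Lemma dunion_basis n : (1 < n)%N -> models (basis n) dunion.
Proof.
move=> n_gt1; apply/models_basis; split=> [A|A B C]; last first.
  by rewrite -!sg_mulA (dunion_mulC B).
have pow0 m : sg_pow A m.+2 = (xpred0 : dunion).
  elim: m => [|m IH]; first exact: dunion_sqr.
  by rewrite sg_powS IH dunion_mulC dunion_mul0.
by case: n n_gt1 => // -[|n] // _; rewrite !pow0.
Qed.

Lemma foldl_dunion0 (f : nat -> dunion) s :
  foldl (fun A i => A * f i) (xpred0 : dunion) s = (xpred0 : dunion).
Proof. by elim: s => //= i s IH; rewrite [dunion_mul _ _]dunion_mul0 IH. Qed.

Lemma eval_dunion_sqr (f : nat -> dunion) x s :
  eval f (x, x :: s) = (xpred0 : dunion).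
Proof. by rewrite /eval /= [dunion_mul _ _]dunion_sqr foldl_dunion0. Qed.

Lemma eval_rcons (S : semigroup) (f : nat -> S) x s y :
  eval f (x, rcons s y) = eval f (x, s) * f y.
Proof. by rewrite /eval /= foldl_rcons. Qed.

Lemma count_dunionU (A B : nat -> bool) : ~~ inhab (predI A B) ->
  count (fun i => (i < k)%N && (A i || B i)) (iota 0 k) =
  (count A (iota 0 k) + count B (iota 0 k))%N.
Proof.
move=> AB; have /eq_in_count -> : {in iota 0 k,
    (fun i => (i < k)%N && (A i || B i)) =1 predU A B}.
  by move=> i; rewrite mem_iota /= => ->.
rewrite -count_predUI; move: AB; rewrite /inhab has_count.
by case: (count (predI A B) _); rewrite ?addn0.
Qed.

(** A nonzero product is a disjoint union of [size s + 1] nonempty sets, each of which contributes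
    at least one element. *)
Lemma count_eval_dunion (f : nat -> dunion) x s :
  inhab (eval f (x, s)) -> (size s < count (eval f (x, s)) (iota 0 k))%N.
Proof.
elim/last_ind: s => [|s y IH]; first by rewrite /inhab has_count.
rewrite eval_rcons [X in inhab X]/= [X in count X _]/= /dunion_mul.
case: ifP => [/and3P[A0 B0 AB] _|_]; last by rewrite inhab0.
rewrite count_dunionU // size_rcons -addn1 -[(size s).+1]addn1.
by move: (IH A0) B0; rewrite /inhab [has (f y) _]has_count; lia.
Qed.

Lemma eval_dunion_long (f : nat -> dunion) x s :
  (0 < k <= size s)%N -> eval f (x, s) = (xpred0 : dunion).
Proof.
case/lastP: s => [|s y]; first by case: k.
move=> /andP[_]; rewrite eval_rcons /= /dunion_mul.
case: ifP => // /and3P[A0 B0 AB].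
have := count_size
  (fun i => (i < k)%N && (eval f (x, s) i || f y i)) (iota 0 k).
rewrite count_dunionU // size_iota size_rcons.
have := count_eval_dunion A0; move: B0; rewrite /inhab has_count; lia.
Qed.

End DisjointUnions.

(** * Identities that separate infinitely many subvarieties *)

Definition square_identity (m : nat) : identity :=
  ((0, iota 1 m), (0, 0 :: iota 1 m)).

(** The right-hand side contains a square, so it always vanishes. The left-hand side has [m + 1]
    factors: it vanishes identically if these exceed [k], and otherwise distinct singletons give a
    nonzero value. *)
Lemma dunion_square_identity k m : (0 < k)%N ->
  holds (dunion k) (square_identity m) <-> (k <= m)%N.
Proof.
move=> k_gt0; split=> [sq|le_km f]; last first.
  by rewrite eval_dunion_sqr; apply: eval_dunion_long; rewrite size_iota k_gt0.
rewrite leqNgt; apply/negP => lt_mk.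
pose f i : dunion k := fun j => j == i.
have := sq f; rewrite eval_dunion_sqr.
(* On singletons the product of the letters 0 to [j] is the set {0, ..., j}; for [j = m] it contains
   [m]. *)
suff evalE j : (j < k)%N ->
    forall i, (i < k)%N -> eval f (0, iota 1 j) i = (i <= j)%N.
  by move=> /(congr1 (fun A : dunion k => A m)); rewrite evalE ?leqnn.
elim: j => [|j IH] ltj i lti; first by rewrite leqn0.
have -> : iota 1 j.+1 = rcons (iota 1 j) j.+1.
  by rewrite -[in LHS](addn1 j) iotaD cats1 add1n.
rewrite eval_rcons /= /dunion_mul.
have in0 : inhab k (eval f (0, iota 1 j)).
  by apply/hasP; exists 0; rewrite ?mem_iota // IH // ltnW.
have inj : inhab k (f j.+1).
  by apply/hasP; exists j.+1; rewrite ?mem_iota // /f eqxx.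
have disj : ~~ inhab k (predI (eval f (0, iota 1 j)) (f j.+1)).
  apply/hasPn => l; rewrite mem_iota /= => ltl.
  rewrite IH // ?(ltnW ltj) // /f; apply/negP => /andP[lej /eqP lE].
  by rewrite lE ltnn in lej.
by rewrite in0 inj disj /= lti IH ?(ltnW ltj) // /f [RHS]leq_eqVlt orbC.
Qed.

Theorem propositionC11 (n : nat) (hn : (2 <= n)%N) :
  let V := var [set LZ2; adjoin1 (nilsg n)] in
  let x := letter 0 in
  let y := letter 1 in
  let a := letter 2 in
  identity_basis
    [set (sg_pow x n.+1, sg_pow x n); (a * x * y, a * y * x)] V /\
  subvarieties V #= [set: nat].
Proof.
move=> V x y a.
have Vvar : variety V by apply: smallest_variety.
have Vgen : [set LZ2; adjoin1 (nilsg n)] `<=` V by apply: sub_gen_smallest.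
have Vtrunc u v : satisfies V (u, v) -> trunc_equiv n u v.
  move=> Vuv; apply: holds_trunc_equiv => //; apply: Vuv; apply: Vgen.
    by left.
  by right.
have basisV : identity_basis (basis n) V.
  split=> [e Be S VS|[u v] Ve]; last first.
    by apply: trunc_equiv_deducible (Vtrunc _ _ Ve); apply: ltnW.
  have /(_ S VS) : V `<=` models (basis n).
    apply: smallest_sub; first exact: models_variety.
    by move=> _ [->|->]; [apply: LZ2_basis|apply: nil1_basis].
  exact.
split=> //.
have VE := identity_basis_models Vvar basisV.
have Vsound S u v : V S -> trunc_equiv n u v -> holds S (u, v).
  rewrite VE => VS uv; apply: deducible_sound VS _.
  by apply: trunc_equiv_deducible uv; apply: ltnW.
apply: eq_card_nat.
  (* Countability: a subvariety is recovered from a finite list of identities, and such lists are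
     countable. *)
  have /choice[code codeP] (W : set semigroup) : exists s : seq identity,
      subvarieties V W -> W = V `&` models [set` s].
    have [[Wvar WV]|notW] := pselect (subvarieties V W); last by exists [::].
    have [s sW sP] := finite_relative_basis n (identities W).
    exists s => _; apply/seteqP; split=> S.
      by move=> WS; split=> [|e /sW]; [apply: WV|apply].
    move=> [VS Ss]; rewrite (variety_models Wvar).
    by apply: sP Ss => u v; apply: Vsound.
  apply/countable_injP; exists (fun W => pickle (code W)) => W1 W2.
  rewrite !inE => /codeP W1E /codeP W2E /(pcan_inj choice.pickleK) eq_code.
  by rewrite W1E W2E eq_code.
apply/infiniteP.
pose W m := V `&` models [set square_identity m].
have Wsub : range W `<=` subvarieties V.
  move=> _ [m _ <-]; split; last by move=> S [].
  have -> : W m = models (basis n `|` [set square_identity m]).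
    rewrite /W VE; apply/seteqP; split=> S.
      by move=> [BS SS] e [/BS|/SS].
    by move=> US; split=> e Ee; apply: US; [left|right].
  exact: models_variety.
apply: card_le_trans (subset_card_le Wsub).
have Winj : injective W.
  move=> i j Wij.
  (* If i < j, then [dunion i.+1] lies in [W j] but not in [W i]. *)
  have dunionW k m : W m (dunion k.+1) <-> (k < m)%N.
    rewrite -(dunion_square_identity m (ltn0Sn k)); split=> [[_]|sq].
      by move=> /(_ _ erefl).
    split; first by rewrite VE; apply: dunion_basis.
    by move=> _ ->.
  apply/eqP; rewrite eqn_leq.
  apply/andP; split; rewrite leqNgt; apply/negP => lt.
    by have := (dunionW j i).2 lt; rewrite Wij => /dunionW; rewrite ltnn.
  by have := (dunionW i j).2 lt; rewrite -Wij => /dunionW; rewrite ltnn.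
have : range W #= [set: nat] by apply: inj_card_eq => i j _ _ /Winj.
by rewrite card_eq_le => /andP[].
Qed.
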